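(* Let $g_1$ and $g_2$ be graphs such that $g_1\ll g_2$, i.e. $g_1$ is a shaved version of $g_2$. Then $g_2\xrightarrow{A\bot} g_1$, i.e. $g_2$ equi-implies $g_1$ by the $A\bot$-criterion.
   Context: Boolean formulae. Fix a countable set of variables. A literal is a variable $x$, its negation $\overline{x}$, or a constant $\top$, $\bot$. A clause is a disjunction of one or more literals, viewed as a set of literals. A Cnf is a conjunction of one or more clauses, viewed as a set of clauses. An assignment is a set of literals not containing both a literal and its negation. For a Cnf $x$ and assignment $a$, $x[a]$ is the Cnf obtained by replacing, for each $l\in a$, every occurrence of $l$ in $x$ by $\top$ and every occurrence of $\overline{l}$ by $\bot$, simplified by the usual rules for $\top,\bot$. Graphs. Each vertex $v$ is also a boolean variable. An edge is a nonempty set of vertices; a graph is a nonempty multiset of edges, written $(e_1)^{n_1}\cdots(e_m)^{n_m}$ with $n_i$ the multiplicity of $e_i$. The edge $v_1\cdots v_k$ supports the $2^k$ clauses $l_1\vee\cdots\vee l_k$ with $l_i\in\{v_i,\overline{v_i}\}$. The edge $e$ with multiplicity $n$ corresponds to the set of all Cnfs $c_1\wedge\cdots\wedge c_n$ with $c_1,\dots,c_n$ pairwise distinct clauses supported on $e$. A graph $(e_1)^{n_1}\cdots(e_m)^{n_m}$ is identified with the set of all Cnfs $x_1\wedge\cdots\wedge x_m$ with $x_i$ in the set corresponding to $e_i$ with multiplicity $n_i$. An edge $e$ is a face of an edge $f$ if every vertex of $e$ is a vertex of $f$. A graph $g$ is a shaved version of a graph $h$, $g\ll h$, if $g$ can be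 constructed by replacing each edge of $h$ (counting duplicates as distinct) by a nonempty face of itself. For sets of Cnfs $s_1,s_2$, we say $s_1$ equi-implies $s_2$ by the $A\bot$-criterion, written here $s_1\xrightarrow{A\bot}s_2$, if for every Cnf $x_1\in s_1$ there exists a Cnf $x_2\in s_2$ such that for every assignment $a$, $x_1[a]=\bot$ implies $x_2[a]=\bot$.
   Formalization: The formal statement also assumes that every edge of g_1 with k vertices has multiplicity at most 2^k; without this the set of g_1 may be empty and the claim fails, e.g. g_2=(xy)^3, g_1=(x)^3. *)

(* Defs.v *)
From HB Require Import structures.
From mathcomp Require Import all_boot.
From mathcomp Require Import finmap multiset.
From mathcomp Require Import classical_sets.

Set Implicit Arguments.
Unset Strict Implicit.
Unset Printing Implicit Defensive.

Local Open Scope fset_scope.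
Local Open Scope classical_set_scope.

(* Clauses, Cnfs and edges are all finite *nonempty* sets. *)
Record nfset (K : choiceType) :=
  NFSet { nfset_val :> {fset K}; nfset_neq0 : nfset_val != fset0 }.

HB.instance Definition _ K := [isSub for @nfset_val K].
HB.instance Definition _ K := [Choice of nfset K by <:].

Lemma nfset1_neq0 (K : choiceType) (k : K) : [fset k] != fset0.
Proof. by apply/fset0Pn; exists k; rewrite in_fset1. Qed.

Definition nfset1 (K : choiceType) (k : K) : nfset K := NFSet (nfset1_neq0 k).

Lemma nfmap_neq0 (K L : choiceType) (f : K -> L) (s : nfset K) :
  [fset f k | k in nfset_val s] != fset0.
Proof.
have /fset0Pn[k ks] := nfset_neq0 s.
by apply/fset0Pn; exists (f k); apply: in_imfset.
Qed.

Definition nfmap (K L : choiceType) (f : K -> L) (s : nfset K) : nfset L :=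
  NFSet (nfmap_neq0 f s).

Inductive literal (V : Type) : Type :=
  Pos of V | Neg of V | Top | Bot.

Arguments Top {V}.
Arguments Bot {V}.

Definition literal_code V (l : literal V) : V + V + bool :=
  match l with
  | Pos v => inl (inl v)
  | Neg v => inl (inr v)
  | Top => inr true
  | Bot => inr false
  end.

Definition literal_decode V (u : V + V + bool) : literal V :=
  match u with
  | inl (inl v) => Pos v
  | inl (inr v) => Neg v
  | inr true => Top
  | inr false => Bot
  end.

Lemma literal_codeK V : cancel (@literal_code V) (@literal_decode V).
Proof. by case. Qed.

HB.instance Definition _ (V : countType) :=
  Countable.copy (literal V) (can_type (@literal_codeK V)).

Definition negl V (l : literal V) : literal V :=
  match l with
  | Pos v => Neg v
  | Neg v => Pos v
  | Top => Bot
  | Bot => Top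
  end.

Section Formulae.
Variable V : countType.

Definition clause := nfset (literal V).
Definition cnf := nfset clause.

Definition top_clause : clause := nfset1 Top.
Definition bot_clause : clause := nfset1 Bot.
Definition top_cnf : cnf := nfset1 top_clause.
Definition bot_cnf : cnf := nfset1 bot_clause.

Definition assignment (a : set (literal V)) : Prop :=
  forall l, ~ (a l /\ a (negl l)).

Definition subst_literal (a : set (literal V)) (l : literal V) : literal V :=
  if l \in a then Top else if negl l \in a then Bot else l.

(* [insubd d s] is [s] if [s] is nonempty, and [d] otherwise: a disjunction
   with no literal left is false, a conjunction with no clause left is true. *)
Definition simpl_clause (c : clause) : clause :=
  if Top \in nfset_val c then top_clause
  else insubd bot_clause (nfset_val c `\ Bot)%fset.

Definition simpl_cnf (x : cnf) : cnf :=
  let y := nfmap simpl_clause x in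
  if bot_clause \in nfset_val y then bot_cnf
  else insubd top_cnf (nfset_val y `\ top_clause)%fset.

Definition subst_cnf (a : set (literal V)) (x : cnf) : cnf :=
  simpl_cnf (nfmap (nfmap (subst_literal a)) x).

Definition edge := nfset V.

Record graph :=
  Graph { graph_val :> {mset edge}%mset; graph_neq0 : graph_val != mset0 }.

(* [s v] chooses between the two literals on the vertex [v]. *)
Definition supports (e : edge) (c : clause) : Prop :=
  exists s : V -> bool,
    c = nfmap (fun v => if s v then Pos v else Neg v) e.

Definition cnfs_of_edge (e : edge) (n : nat) : set cnf :=
  [set x | #|` nfset_val x| = n /\
           forall c, c \in nfset_val x -> supports e c].

Definition cnfs_of_graph (g : graph) : set cnf :=
  [set x | exists y : edge -> cnf,
    (forall e, e \in finsupp (graph_val g) ->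
       cnfs_of_edge e (graph_val g e) (y e)) /\
    nfset_val x =
      (\bigcup_(e <- finsupp (graph_val g)) nfset_val (y e))%fset].

Definition face (e f : edge) : bool := (nfset_val e `<=` nfset_val f)%fset.

(* [enum_mset h] lists the edges of [h] with repetition; [r] lists the faces
   replacing them. *)
Definition shaved (g h : graph) : Prop :=
  exists r : seq edge,
    all2 face r (enum_mset (graph_val h)) /\ graph_val g = seq_mset r.

Definition equi_implies_Abot (s1 s2 : set cnf) : Prop :=
  forall x1, s1 x1 -> exists x2, s2 x2 /\
    forall a, assignment a ->
      subst_cnf a x1 = bot_cnf -> subst_cnf a x2 = bot_cnf.

End Formulae.

(* Main.v *)
Require Import Defs.
From mathcomp Require Import all_boot finmap multiset classical_sets.
From mathcomp Require Import boolp.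

(** A Cnf collapses to the false Cnf under an assignment exactly when the
    assignment turns every literal of one of its clauses into [Bot].  Hence it
    is enough that every clause of the Cnf [x1] of [g2] contains a clause of the
    Cnf [x2] of [g1]: what falsifies a clause falsifies all its subclauses
    ([subst_cnf_bot_subclause]).

    To build [x2], view [x1] as one clause per edge copy of [g2].  When a copy
    of [f] is shaved to its face [e], its clause is cut down to the literals on
    [e], which gives a subclause supported on [e].  The copies of [e] in [g1]
    thus receive at most as many distinct clauses as there are copies; distinct
    clauses on [f] may well become equal on [e], and then there are fewer.  The
    bound on the multiplicity of [e] leaves room to complete them to the exact
    number with arbitrary other clauses on [e] ([exists_cnf_of_edge]); adding
    clauses only makes [x2] easier to falsify. *)

Set Implicit Arguments.
Unset Strict Implicit.
Unset Printing Implicit Defensive.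

Local Open Scope fset_scope.

(** * Clauses falsified by a substitution *)

Section Falsification.
Variable V : countType.
Implicit Types (c d : clause V) (x y : cnf V).

Lemma simpl_clause_bot c :
  reflect {in nfset_val c, forall l, l = Bot} (simpl_clause c == bot_clause V).
Proof.
rewrite /simpl_clause -val_eqE /=; apply: (iffP eqP).
  case: ifP => [Tc /fsetP/(_ Top)|_]; first by rewrite /= !in_fset1.
  rewrite val_insubd; case: ifPn => [_ E l lc|].
    move/fsetP/(_ l): E; rewrite !inE lc andbT.
    by case: eqP.
  rewrite negbK => /eqP/fsetP E _ l lc.
  by move: (E l); rewrite !inE lc andbT; case: eqP.
move=> cB; case: ifPn => [/cB //|_].
rewrite val_insubd; case: ifPn => // /fset0Pn[l].
by rewrite !inE => /andP[/eqP nB /cB].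
Qed.

Lemma simpl_cnf_bot x :
  reflect (exists2 c, c \in nfset_val x & {in nfset_val c, forall l, l = Bot})
          (simpl_cnf x == bot_cnf V).
Proof.
have topNbot : top_clause V != bot_clause V.
  by apply/eqP => /(congr1 (@nfset_val _))/fsetP/(_ Top); rewrite /= !in_fset1.
have imB : reflect
    (exists2 c, c \in nfset_val x & {in nfset_val c, forall l, l = Bot})
    (bot_clause V \in nfset_val (nfmap (@simpl_clause V) x)).
  apply: (iffP idP) => [/imfsetP[c /= cx] /esym/eqP/simpl_clause_bot cB|].
    by exists c.
  by case=> c cx /simpl_clause_bot/eqP <-; apply: in_imfset.
suff -> : (simpl_cnf x == bot_cnf V)
        = (bot_clause V \in nfset_val (nfmap (@simpl_clause V) x)) by [].
rewrite /simpl_cnf; case: ifPn => [_|nB]; first exact: eqxx.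
apply/negbTE/eqP => /(congr1 (@nfset_val _))/fsetP/(_ (bot_clause V)).
rewrite val_insubd /= in_fset1 eqxx; case: ifP => _.
  by rewrite in_fsetD1 (negbTE nB) andbF.
by rewrite in_fset1 eq_sym (negbTE topNbot).
Qed.

Lemma subst_cnf_bot (a : set (literal V)) x :
  subst_cnf a x = bot_cnf V <->
  exists2 c, c \in nfset_val x &
             {in nfset_val c, forall l, subst_literal a l = Bot}.
Proof.
rewrite (rwP eqP) -(rwP (simpl_cnf_bot _)); split.
  case=> _ /imfsetP[c /= cx ->] cB; exists c => // l lc.
  by apply: cB; apply: in_imfset.
case=> c cx cB; exists (nfmap (subst_literal a) c); first exact: in_imfset.
by move=> _ /imfsetP[l /= lc ->]; apply: cB.
Qed.

Lemma subst_cnf_bot_subclause (a : set (literal V)) x y :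
  {in nfset_val x, forall c, exists2 d, d \in nfset_val y &
                                        nfset_val d `<=` nfset_val c} ->
  subst_cnf a x = bot_cnf V -> subst_cnf a y = bot_cnf V.
Proof.
move=> sub_xy /subst_cnf_bot[c cx cB]; apply/subst_cnf_bot.
have [d dy /fsubsetP dc] := sub_xy c cx.
by exists d => // l /dc /cB.
Qed.

End Falsification.

(** * Clauses supported on an edge *)

Section SupportedClauses.
Variable V : countType.
Implicit Types (c : clause V) (e f : edge V) (s : V -> bool).

Definition sign_clause e s : clause V :=
  nfmap (fun v => if s v then Pos v else Neg v) e.

Lemma Pos_sign_clause e s v :
  (Pos v \in nfset_val (sign_clause e s)) = (v \in nfset_val e) && s v.
Proof.
apply/imfsetP/andP => [[w /= we]|[ve sv]]; last by exists v; rewrite ?sv.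
by case: ifP => // sw [->].
Qed.

(** There are [2 ^ k] clauses on an edge with [k] vertices: a clause is
    determined by the set of the vertices that it contains positively. *)
Definition edge_clauses e : {fset clause V} :=
  [fset sign_clause e (mem A) | A : {fset V} in fpowerset (nfset_val e)].

Lemma edge_clausesP e c : reflect (supports e c) (c \in edge_clauses e).
Proof.
apply: (iffP (imfsetP _ _ _ _)) => [[A _ ->]|[s ->]]; first by exists (mem A).
exists [fset v in nfset_val e | s v]; first by rewrite fpowersetE fset_sub.
apply/val_inj/eq_in_imfset => //= v /= ve.
by rewrite !inE /= ve.
Qed.

Lemma card_edge_clauses e : #|` edge_clauses e| = 2 ^ #|` nfset_val e|.
Proof.
rewrite card_in_imfset ?card_fpowerset // => A B /=.
rewrite !fpowersetE => /fsubsetP Ae /fsubsetP Be eqAB.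
apply/fsetP => v; have := Pos_sign_clause e (mem A) v.
rewrite eqAB Pos_sign_clause /=.
case: (boolP (v \in nfset_val e)) => [_ //=|ve _].
by rewrite (contraNF (Ae v) ve) (contraNF (Be v) ve).
Qed.

(** For a clause on an edge, a vertex that does not occur positively occurs
    negatively, so the positive literals determine the part on a face. *)
Definition restrict_clause e c : clause V :=
  sign_clause e (fun v => Pos v \in nfset_val c).

Lemma restrict_clause_sub e f c :
  face e f -> supports f c -> nfset_val (restrict_clause e c) `<=` nfset_val c.
Proof.
move=> /fsubsetP ef [s ->]; apply/fsubsetP => _ /imfsetP[v /= /ef vf ->].
rewrite -/(sign_clause f s) Pos_sign_clause vf /=.
by case: ifP => sv; apply/imfsetP; exists v; rewrite ?sv.
Qed.

End SupportedClauses.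

Lemma fset_subset_card (K : choiceType) (A B : {fset K}) n :
  A `<=` B -> #|` A| <= n <= #|` B| ->
  exists C, [/\ A `<=` C, C `<=` B & #|` C| = n].
Proof.
move=> AB; elim: n => [|n IHn] /andP[An nB].
  by exists A; split=> //; apply/eqP; rewrite -leqn0.
move: An; rewrite leq_eqVlt => /orP[/eqP <-|An]; first by exists A.
have [|C [AC CB Cn]] := IHn; first by rewrite -ltnS An ltnW.
have /fset0Pn[k] : B `\` C != fset0.
  by rewrite -cardfs_gt0 cardfsDS // Cn subn_gt0.
rewrite in_fsetD => /andP[kC kB]; exists (k |` C); split.
- exact: fsubset_trans AC (fsubsetUr _ _).
- by rewrite fsubUset fsub1set kB.
- by rewrite cardfsU1 kC Cn.
Qed.

Lemma exists_cnf_of_edge (V : countType) (e : edge V) n (S : {fset clause V}) :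
  0 < n <= 2 ^ #|` nfset_val e| -> #|` S| <= n ->
  {in S, forall c, supports e c} ->
  exists2 y : cnf V, cnfs_of_edge e n y & S `<=` nfset_val y.
Proof.
case/andP=> n_gt0 n_le Sn Se.
have [||C [SC /fsubsetP Ce Cn]] := @fset_subset_card _ S (edge_clauses e) n.
- by apply/fsubsetP => c /Se /edge_clausesP.
- by rewrite Sn card_edge_clauses.
have C0 : C != fset0 by rewrite -cardfs_gt0 Cn.
by exists (NFSet C0) => //; split=> // c /Ce /edge_clausesP.
Qed.

(** * Shaving a Cnf *)

(** Families of lists [Y f] can be laid out along a list in which each [f]
    occurs [size (Y f)] times.  This turns the clauses attached to an edge with
    multiplicity into clauses attached to its individual copies. *)
Lemma distribute (T U : eqType) (s : seq T) (Y : T -> seq U) :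
  (forall t, size (Y t) = count_mem t s) ->
  exists2 p : seq (T * U), unzip1 p = s &
                           forall t u, ((t, u) \in p) = (u \in Y t).
Proof.
elim: s Y => [|t s IHs] Y sizeY.
  by exists [::] => // t u; rewrite in_nil (size0nil (sizeY t)).
have [u0 Yt] : exists u0, Y t = u0 :: behead (Y t).
  by move: (sizeY t); rewrite /= eqxx; case: (Y t) => // u0 us _; exists u0.
pose Y' t' := if t' == t then behead (Y t) else Y t'.
have [|p ps memp] := IHs Y'.
  move=> t'; rewrite /Y' eq_sym; case: eqP => [<-|/eqP/negbTE tt'].
    by rewrite size_behead sizeY /= eqxx.
  by rewrite sizeY /= tt'.
exists ((t, u0) :: p) => [|t' u]; first by rewrite /= ps.
rewrite inE memp /Y' xpair_eqE.
by case: eqP => //= ->; rewrite [in RHS]Yt inE.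
Qed.

Lemma shaved_subclauses (V : countType) (g1 g2 : graph V) (x1 : cnf V) :
  (forall e, graph_val g1 e <= 2 ^ #|` nfset_val e|) ->
  shaved g1 g2 -> cnfs_of_graph g2 x1 ->
  exists2 x2, cnfs_of_graph g1 x2 &
    {in nfset_val x1, forall c, exists2 d, d \in nfset_val x2 &
                                           nfset_val d `<=` nfset_val c}.
Proof.
move=> mult1 [r [face_r g1r]] [y [yP x1E]].
pose Y f : seq (clause V) :=
  if f \in finsupp (graph_val g2) then enum_fset (nfset_val (y f)) else [::].
have [|p pE memp] := @distribute _ _ (enum_mset (graph_val g2)) Y.
  move=> f; rewrite count_mem_mset /Y; case: ifPn => [/yP[]//|].
  by rewrite memNfinsupp => /eqP ->.
have supp_p f c : (f, c) \in p -> supports f c.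
  by rewrite memp /Y; case: ifP => // /yP[_]; apply.
(* An entry of [q] is a copy of an edge of [g2], as a triple: the face that
   replaces it, the edge, the clause of [x1] on this copy. *)
pose q := zip r p.
move: face_r; rewrite -pE all2E size_map => /andP[/eqP size_rp /allP face_rp].
have q1 : unzip1 q = r by rewrite unzip1_zip // size_rp.
have q2 : unzip2 q = p by rewrite unzip2_zip // size_rp.
have face_q t : t \in q -> face t.1 t.2.1.
  move=> tq; apply: (face_rp (t.1, t.2.1)).
  have -> : zip r (unzip1 p) = [seq (t.1, t.2.1) | t <- q].
    rewrite -(zip_map fst (fst \o snd)) map_comp.
    by rewrite -/(unzip1 q) -/(unzip2 q) q1 q2.
  exact: map_f tq.
pose S e := [fset d in [seq restrict_clause e t.2.2 | t <- q & t.1 == e]].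
have cardS e : #|` S e| <= graph_val g1 e.
  rewrite g1r mset_seqE -q1 count_map -size_filter.
  by rewrite card_fseq (leq_trans (size_undup _)) // size_map.
(* Off the support of [g1], where nothing is required, any Cnf will do. *)
have /choice[y2 y2P] (e : edge V) : exists z : cnf V,
    e \in finsupp (graph_val g1) ->
    cnfs_of_edge e (graph_val g1 e) z /\ S e `<=` nfset_val z.
  case: (boolP (e \in finsupp (graph_val g1))) => [eg1|_]; last first.
    by exists (top_cnf V).
  have [|||z ze Sz] := @exists_cnf_of_edge V e (graph_val g1 e) (S e) => //.
  - by rewrite mult1 lt0n -mem_finsupp eg1.
  - by move=> c; rewrite inE => /mapP[t _ ->]; eexists.
  by exists z.
have X0 : \bigcup_(e <- finsupp (graph_val g1)) nfset_val (y2 e) != fset0.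
  have [/eqP|[e]] := mset_0Vmem (graph_val g1).
    by rewrite (negbTE (graph_neq0 g1)).
  rewrite -msuppE => eg1; have /fset0Pn[c cy] := nfset_neq0 (y2 e).
  by apply/fset0Pn; exists c; apply/bigfcupP; exists e; rewrite ?eg1.
exists (NFSet X0); first by exists y2; split=> // e /y2P[].
move=> c; rewrite x1E => /bigfcupP[f /andP[fg2 _] cf].
have : (f, c) \in unzip2 q by rewrite q2 memp /Y fg2.
case/mapP=> -[e fc] tq /= fcE; subst fc.
have eg1 : e \in finsupp (graph_val g1).
  rewrite mem_finsupp g1r mset_seqE -lt0n -has_count has_pred1 -q1.
  exact: map_f tq.
have [_ /fsubsetP Se] := y2P e eg1.
exists (restrict_clause e c).
  apply/bigfcupP; exists e; rewrite ?eg1 //; apply: Se.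
  by rewrite inE; apply/mapP; exists (e, (f, c)); rewrite // mem_filter eqxx.
apply: restrict_clause_sub (face_q _ tq) _.
by apply: supp_p; rewrite memp /Y fg2.
Qed.

Theorem lemma3p4 (V : countType) (g1 g2 : graph V)
    (hmult : forall e : edge V, graph_val g1 e <= 2 ^ #|` nfset_val e|)
    (hshaved : shaved g1 g2) :
  equi_implies_Abot (cnfs_of_graph g2) (cnfs_of_graph g1).
Proof.
move=> x1 x1g2.
have [x2 x2g1 sub12] := shaved_subclauses hmult hshaved x1g2.
by exists x2; split=> // a _; apply: subst_cnf_bot_subclause.
Qed.
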